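(* Let $R$ be a multiplicatively idempotent congruence-simple semiring. Then $R$ is finite, and $R$ is isomorphic to one of the eight semirings $\mathbb{S}_1,\ldots,\mathbb{S}_8$ given by the operation tables in the context.
   Context: A semiring is a non-empty set $R$ with two binary operations $+$ and $\cdot$ such that $(R,+)$ is a commutative semigroup, $(R,\cdot)$ is a semigroup, and $r(s+t)=rs+rt$, $(r+s)t=rt+st$ for all $r,s,t\in R$ (no zero or identity element is assumed). $R$ is multiplicatively idempotent if $r^2=r$ for all $r\in R$. A (semiring) congruence on $R$ is an equivalence relation $\sim$ on $R$ such that $r\sim s$ implies $r+t\sim s+t$, $tr\sim ts$ and $rt\sim st$ for all $r,s,t\in R$. $R$ is congruence-simple if it has exactly two congruences, namely the equality congruence $\mathrm{id}_R$ and the universal congruence $R\times R$. The semirings $\mathbb{S}_1,\ldots,\mathbb{S}_8$ are as follows (in the tables, the entry in row $x$ and column $y$ is $x+y$, respectively $x\cdot y$). $\mathbb{S}_1,\mathbb{S}_2,\mathbb{S}_3,\mathbb{S}_4$ have underlying set $\{w,a\}$ and all have the same multiplication $$\begin{array}{c|cc} \cdot & w & a \\ \hline w & w & w \\ a & w & a \end{array}$$ and their additions are, respectively, $$\mathbb{S}_1:\ \begin{array}{c|cc} + & w & a \\ \hline w & w & a \\ a & a & w \end{array}\qquad \mathbb{S}_2:\ \begin{array}{c|cc} + & w & a \\ \hline w & w & a \\ a & a & a \end{array}\qquad \mathbb{S}_3:\ \begin{array}{c|cc} + & w & a \\ \hline w & w & w \\ a & w & a \end{array}\qquad \mathbb{S}_4:\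 \begin{array}{c|cc} + & w & a \\ \hline w & w & w \\ a & w & w \end{array}$$ $\mathbb{S}_5,\mathbb{S}_6$ have underlying set $\{a,w\}$, and $$\mathbb{S}_5:\ \begin{array}{c|cc} + & a & w \\ \hline a & a & w \\ w & w & w \end{array}\quad \begin{array}{c|cc} \cdot & a & w \\ \hline a & a & a \\ w & w & w \end{array}\qquad\qquad \mathbb{S}_6:\ \begin{array}{c|cc} + & a & w \\ \hline a & a & w \\ w & w & w \end{array}\quad \begin{array}{c|cc} \cdot & a & w \\ \hline a & a & w \\ w & a & w \end{array}$$ $\mathbb{S}_7,\mathbb{S}_8$ have underlying set $\{a,b,w\}$, and $$\mathbb{S}_7:\ \begin{array}{c|ccc} + & a & b & w \\ \hline a & a & b & w \\ b & b & b & w \\ w & w & w & w \end{array}\quad \begin{array}{c|ccc} \cdot & a & b & w \\ \hline a & a & a & a \\ b & a & b & w \\ w & w & w & w \end{array}\qquad\qquad \mathbb{S}_8:\ \begin{array}{c|ccc} + & a & b & w \\ \hline a & a & b & w \\ b & b & b & w \\ w & w & w & w \end{array}\quad \begin{array}{c|ccc} \cdot & a & b & w \\ \hline a & a & a & w \\ b & a & b & w \\ w & a & w & w \end{array}$$ *)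

(* Defs.v *)
From HB Require Import structures.
From mathcomp Require Import all_boot.
From mathcomp Require Import boolp classical_sets cardinality.

Set Implicit Arguments.
Unset Strict Implicit.
Unset Printing Implicit Defensive.

Local Open Scope classical_set_scope.
Local Open Scope group_scope.
Local Open Scope ring_scope.

(* The library's semigroup structures require a choiceType carrier, so only its
   operations [+] ([hasAdd]) and [*] ([hasMul]) are reused: the carrier is an
   arbitrary type. *)
HB.mixin Record isSemiring R & Algebra.BaseAddMagma R & Magma R := {
  semiring_nonempty : inhabited R;
  semiring_addA : associative (fun x y : R => x + y);
  semiring_addC : commutative (fun x y : R => x + y);
  semiring_mulA : associative (fun x y : R => x * y);
  semiring_mulDr : forall r s t : R, r * (s + t) = r * s + r * t;
  semiring_mulDl : forall r s t : R, (r + s) * t = r * t + s * t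
}.

#[short(type="semiringType")]
HB.structure Definition Semiring :=
  {R of isSemiring R & Algebra.BaseAddMagma R & Magma R}.

Definition mul_idempotent (R : semiringType) : Prop :=
  forall r : R, r * r = r.

Record congruence (R : semiringType) (C : R -> R -> Prop) : Prop := {
  congruence_equiv : RelationClasses.Equivalence C;
  congruence_addr : forall r s t : R, C r s -> C (r + t) (s + t);
  congruence_mull : forall r s t : R, C r s -> C (t * r) (t * s);
  congruence_mulr : forall r s t : R, C r s -> C (r * t) (s * t)
}.

Definition id_rel (R : Type) : R -> R -> Prop := fun x y => x = y.
Definition universal_rel (R : Type) : R -> R -> Prop := fun _ _ => True.

(* Without the second conjunct, a one-element semiring would qualify. *)
Definition congruence_simple (R : semiringType) : Prop :=
  [set C : R -> R -> Prop | congruence C] = [set @id_rel R; @universal_rel R]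
  /\ @id_rel R <> @universal_rel R.

Definition semiring_iso (R S : semiringType) : Prop :=
  exists f : R -> S, [/\ bijective f,
    {morph f : x y / x + y} & {morph f : x y / x * y}].

Variant two := w2 | a2.

Definition two_mul (x y : two) : two :=
  match x, y with
  | w2, w2 => w2 | w2, a2 => w2
  | a2, w2 => w2 | a2, a2 => a2
  end.

Definition S1_add (x y : two) : two :=
  match x, y with
  | w2, w2 => w2 | w2, a2 => a2
  | a2, w2 => a2 | a2, a2 => w2
  end.

Definition S2_add (x y : two) : two :=
  match x, y with
  | w2, w2 => w2 | w2, a2 => a2
  | a2, w2 => a2 | a2, a2 => a2
  end.

Definition S3_add (x y : two) : two :=
  match x, y with
  | w2, w2 => w2 | w2, a2 => w2
  | a2, w2 => w2 | a2, a2 => a2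
  end.

Definition S4_add (x y : two) : two :=
  match x, y with
  | w2, w2 => w2 | w2, a2 => w2
  | a2, w2 => w2 | a2, a2 => w2
  end.

Definition S56_add (x y : two) : two :=
  match x, y with
  | a2, a2 => a2 | a2, w2 => w2
  | w2, a2 => w2 | w2, w2 => w2
  end.

Definition S5_mul (x y : two) : two :=
  match x, y with
  | a2, a2 => a2 | a2, w2 => a2
  | w2, a2 => w2 | w2, w2 => w2
  end.

Definition S6_mul (x y : two) : two :=
  match x, y with
  | a2, a2 => a2 | a2, w2 => w2
  | w2, a2 => a2 | w2, w2 => w2
  end.

Variant three := a3 | b3 | w3.

Definition S78_add (x y : three) : three :=
  match x, y with
  | a3, a3 => a3 | a3, b3 => b3 | a3, w3 => w3
  | b3, a3 => b3 | b3, b3 => b3 | b3, w3 => w3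
  | w3, a3 => w3 | w3, b3 => w3 | w3, w3 => w3
  end.

Definition S7_mul (x y : three) : three :=
  match x, y with
  | a3, a3 => a3 | a3, b3 => a3 | a3, w3 => a3
  | b3, a3 => a3 | b3, b3 => b3 | b3, w3 => w3
  | w3, a3 => w3 | w3, b3 => w3 | w3, w3 => w3
  end.

Definition S8_mul (x y : three) : three :=
  match x, y with
  | a3, a3 => a3 | a3, b3 => a3 | a3, w3 => w3
  | b3, a3 => a3 | b3, b3 => b3 | b3, w3 => w3
  | w3, a3 => a3 | w3, b3 => w3 | w3, w3 => w3
  end.

Definition S1 : Type := two.
HB.instance Definition _ := Algebra.hasAdd.Build S1 S1_add.
HB.instance Definition _ := hasMul.Build S1 two_mul.
Fact S1_semiring : isSemiring S1.
Proof. by split; [exact: (inhabits w2) | case=> -[]; try case | case=> -[] | do 3!case ..]. Qed.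
HB.instance Definition _ := S1_semiring.

Definition S2 : Type := two.
HB.instance Definition _ := Algebra.hasAdd.Build S2 S2_add.
HB.instance Definition _ := hasMul.Build S2 two_mul.
Fact S2_semiring : isSemiring S2.
Proof. by split; [exact: (inhabits w2) | case=> -[]; try case | case=> -[] | do 3!case ..]. Qed.
HB.instance Definition _ := S2_semiring.

Definition S3 : Type := two.
HB.instance Definition _ := Algebra.hasAdd.Build S3 S3_add.
HB.instance Definition _ := hasMul.Build S3 two_mul.
Fact S3_semiring : isSemiring S3.
Proof. by split; [exact: (inhabits w2) | case=> -[]; try case | case=> -[] | do 3!case ..]. Qed.
HB.instance Definition _ := S3_semiring.

Definition S4 : Type := two.
HB.instance Definition _ := Algebra.hasAdd.Build S4 S4_add.
HB.instance Definition _ := hasMul.Build S4 two_mul.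
Fact S4_semiring : isSemiring S4.
Proof. by split; [exact: (inhabits w2) | case=> -[]; try case | case=> -[] | do 3!case ..]. Qed.
HB.instance Definition _ := S4_semiring.

Definition S5 : Type := two.
HB.instance Definition _ := Algebra.hasAdd.Build S5 S56_add.
HB.instance Definition _ := hasMul.Build S5 S5_mul.
Fact S5_semiring : isSemiring S5.
Proof. by split; [exact: (inhabits w2) | case=> -[]; try case | case=> -[] | do 3!case ..]. Qed.
HB.instance Definition _ := S5_semiring.

Definition S6 : Type := two.
HB.instance Definition _ := Algebra.hasAdd.Build S6 S56_add.
HB.instance Definition _ := hasMul.Build S6 S6_mul.
Fact S6_semiring : isSemiring S6.
Proof. by split; [exact: (inhabits w2) | case=> -[]; try case | case=> -[] | do 3!case ..]. Qed.
HB.instance Definition _ := S6_semiring.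

Definition S7 : Type := three.
HB.instance Definition _ := Algebra.hasAdd.Build S7 S78_add.
HB.instance Definition _ := hasMul.Build S7 S7_mul.
Fact S7_semiring : isSemiring S7.
Proof. by split; [exact: (inhabits w3) | case=> -[]; try case | case=> -[] | do 3!case ..]. Qed.
HB.instance Definition _ := S7_semiring.

Definition S8 : Type := three.
HB.instance Definition _ := Algebra.hasAdd.Build S8 S78_add.
HB.instance Definition _ := hasMul.Build S8 S8_mul.
Fact S8_semiring : isSemiring S8.
Proof. by split; [exact: (inhabits w3) | case=> -[]; try case | case=> -[] | do 3!case ..]. Qed.
HB.instance Definition _ := S8_semiring.

(* Main.v *)
Require Import Defs.
From HB Require Import structures.
From mathcomp Require Import all_boot.
From mathcomp Require Import boolp classical_sets cardinality.

(** Every endomorphism [f] of [R] with [f \o f = f] is the identity or constant,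
    because its kernel is a congruence.  The proof feeds this dichotomy with
    three retractions.

    Squaring [x + x] gives [4 x = 2 x], so [x |-> x + x] is a retraction:
    either addition is idempotent or [x + x] is a constant [c], which then
    absorbs products.  In the latter case [x |-> c + x] is a retraction as
    well: either [c] is neutral and [R] is a Boolean ring, or all sums equal
    [c] and [R] is just a band with zero.  Both ways every element other than
    [c] is an identity ([boolean_ring_identity], [constant_addition_identity]),
    so [R = {c, 1}], and the four possible additions are those of [S1] to [S4]
    ([absorbing_or_identity_iso]).

    If addition is idempotent, it is the join of an order preserved by products,
    and squaring [x + y] gives [x y <= x + y].  From this inequality follows
    [z x z y z = z x y z] ([regular_band]), which says that [x |-> e x e] is a
    retraction for each [e].  Hence each [e] is an identity or satisfies
    [e x e = e] for all [x]; let [K] be the set of elements of the second kind,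
    an ideal and a rectangular band.  If [K = {c}], then [c] is absorbing and
    [R = {c, 1}] again.  Otherwise simplicity makes [K] consist of left zeros or
    of right zeros ([sandwich_left_or_right_zeros]); these cases are exchanged
    by reversing the multiplication.  For left zeros, if there is no identity
    then only the order matters and [R] is [S5]; with an identity, comparing it
    with [x] in [K] shows that [x] is the top or the bottom of [R], so that
    [R = {bottom, 1, top}] is [S7] ([left_zeros_iso]). *)

Set Implicit Arguments.
Unset Strict Implicit.
Unset Printing Implicit Defensive.

Local Open Scope classical_set_scope.
Local Open Scope group_scope.
Local Open Scope ring_scope.

(** * Elementary rules *)

Section Rules.
Variable R : semiringType.
Implicit Types x y z : R.

Lemma addA x y z : x + (y + z) = x + y + z.
Proof. exact: semiring_addA. Qed.

Lemma addC x y : x + y = y + x.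
Proof. exact: semiring_addC. Qed.

Lemma addAC x y z : x + y + z = x + z + y.
Proof. by rewrite -!addA (addC y). Qed.

Lemma addACA x y z t : x + y + (z + t) = x + z + (y + t).
Proof. by rewrite !addA (addAC x y). Qed.

Lemma mulA x y z : x * (y * z) = x * y * z.
Proof. exact: semiring_mulA. Qed.

Lemma mulDr x y z : x * (y + z) = x * y + x * z.
Proof. exact: semiring_mulDr. Qed.

Lemma mulDl x y z : (x + y) * z = x * z + y * z.
Proof. exact: semiring_mulDl. Qed.

Lemma sqr_sum x y : mul_idempotent R -> x + y = x + x * y + (y * x + y).
Proof. by move=> idem; rewrite -[LHS]idem mulDl !mulDr !idem. Qed.

End Rules.

Definition le (R : semiringType) (x y : R) : Prop := x + y = y.

Definition identity (R : semiringType) (e : R) : Prop :=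
  forall x : R, e * x = x /\ x * e = x.

Definition left_zero (R : semiringType) (e : R) : Prop :=
  forall x : R, e * x = e.

Definition absorbing (R : semiringType) (c : R) : Prop :=
  forall x : R, c * x = c /\ x * c = c.

Lemma identity_unique (R : semiringType) (e f : R) :
  identity e -> identity f -> e = f.
Proof. by move=> /(_ f)[_ fe] /(_ e)[<- _]. Qed.

(** * Congruences and endomorphisms of congruence-simple semirings *)

Section Simple.
Variable R : semiringType.
Hypothesis R_simple : congruence_simple R.
Implicit Types x y z e c : R.

Lemma simple_congruence (C : R -> R -> Prop) : congruence C ->
  (forall x y, C x y -> x = y) \/ (forall x y, C x y).
Proof.
move=> Ccong.
have : [set C : R -> R -> Prop | congruence C] C by [].
by rewrite (proj1 R_simple) => -[]->; [left | right].
Qed.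

Lemma simple_nontrivial : exists x y : R, x <> y.
Proof.
apply: contrapT => /forallNP trivR; apply: (proj2 R_simple).
apply/funext => x; apply/funext => y; apply/propext; split=> // _.
by apply: contrapT => xy; apply: (trivR x); exists y.
Qed.

Lemma simple_nontrivial_at c : exists x, x <> c.
Proof.
have [x [y xy]] := simple_nontrivial.
case: (pselect (x = c)) => [xc|]; last by exists x.
by exists y => yc; apply: xy; rewrite xc yc.
Qed.

(** The kernel of an endomorphism is a congruence, so an endomorphism is
    injective or constant; an injective idempotent map is the identity. *)
Lemma simple_retraction (f : R -> R) :
    {morph f : x y / x + y} -> {morph f : x y / x * y} ->
    (forall x, f (f x) = f x) ->
  (forall x, f x = x) \/ (forall x y, f x = f y).
Proof.
move=> fD fM ff.
have : congruence (fun x y => f x = f y).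
  split; first by split=> [x|x y|x y z] // -> .
  - by move=> r s t rs; rewrite !fD rs.
  - by move=> r s t rs; rewrite !fM rs.
  - by move=> r s t rs; rewrite !fM rs.
case/simple_congruence => [finj|]; last by right.
by left=> x; apply: finj.
Qed.

(** The law [z x y z = z x z y z] is what makes [x |-> e x e] an
    endomorphism. *)
Lemma identity_or_sandwich e :
    mul_idempotent R ->
    (forall x y z, z * x * z * y * z = z * x * y * z) ->
  identity e \/ (forall x, e * x * e = e).
Proof.
move=> idem regular.
have [x y|x y|x|eq_id|eq_const] := simple_retraction (f := fun x => e * x * e).
- by rewrite mulDr mulDl.
- by rewrite !mulA -(mulA (e * x) e e) idem regular.
- by rewrite !mulA idem -mulA idem.
- left=> x; split; first by rewrite -{1}(eq_id x) !mulA idem eq_id.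
  by rewrite -{1}(eq_id x) -mulA idem eq_id.
- by right=> x; rewrite (eq_const x e) !idem.
Qed.

End Simple.

(** * Recognising the eight semirings *)

Lemma semiring_iso_onto (R S : semiringType) (g : S -> R) :
    injective g -> (forall x, exists s, g s = x) ->
    {morph g : x y / x + y} -> {morph g : x y / x * y} ->
  semiring_iso R S.
Proof.
move=> ginj /choice[f gf] gD gM; exists f; split.
- by exists g => // s; apply: ginj; rewrite gf.
- by move=> x y; apply: ginj; rewrite gD !gf.
- by move=> x y; apply: ginj; rewrite gM !gf.
Qed.

(** The products are forced, and so is [c + c = c (e + e) = c]; the four
    semirings are the four possible values of [e + c] and [e + e]. *)
Lemma absorbing_or_identity_iso (R : semiringType) (c e : R) :
    absorbing c -> e <> c -> (forall x : R, x <> c -> identity x) ->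
  semiring_iso R S1 \/ semiring_iso R S2 \/ semiring_iso R S3 \/
  semiring_iso R S4.
Proof.
move=> c_abs ec nc_id; have e_id := nc_id _ ec.
have split_R x : x = c \/ x = e.
  case: (pselect (x = c)) => [|/nc_id x_id]; first by left.
  by right; apply: identity_unique.
have cc : c + c = c.
  rewrite -{3}(proj1 (c_abs (e + e))) mulDr.
  by rewrite (proj1 (c_abs e)).
pose g (s : two) := if s is w2 then c else e.
have ginj : injective g by case=> -[] //= /esym.
have gsurj x : exists s, g s = x.
  by case: (split_R x) => ->; [exists w2 | exists a2].
have gM : {morph g : x y / two_mul x y >-> x * y}.
  by case=> -[] /=; rewrite ?(proj1 (c_abs _)) ?(proj2 (c_abs _))
    ?(proj1 (e_id _)).
have := split_R (e + e); have := split_R (e + c).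
case=> ec' [] ee.
- right; right; right; apply: (@semiring_iso_onto _ S4 g) => //.
  by case=> -[] /=; rewrite ?cc ?ee ?ec' // addC ec'.
- right; right; left; apply: (@semiring_iso_onto _ S3 g) => //.
  by case=> -[] /=; rewrite ?cc ?ee ?ec' // addC ec'.
- left; apply: (@semiring_iso_onto _ S1 g) => //.
  by case=> -[] /=; rewrite ?cc ?ee ?ec' // addC ec'.
- right; left; apply: (@semiring_iso_onto _ S2 g) => //.
  by case=> -[] /=; rewrite ?cc ?ee ?ec' // addC ec'.
Qed.

Section LeftZeros.
Variable R : semiringType.
Hypothesis R_simple : congruence_simple R.
Hypothesis addxx : forall x : R, x + x = x.
Implicit Types x y z t : R.

(** When multiplication is the first projection, only the order
    matters.  Lying in the principal down-set of [a] is then compatible with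
    both operations, so it separates all elements and there are just two. *)
Lemma left_zero_band_iso : (forall x, left_zero x) -> semiring_iso R S5.
Proof.
move=> lz.
have [a [b ba]] : exists a b : R, ~ le b a.
  have [x [y xy]] := simple_nontrivial R_simple.
  case: (pselect (le x y)) => [xy_y|xy_neq]; last by exists y, x.
  by exists x, y => yx_x; apply: xy; rewrite -yx_x addC.
have le_add x t : le (x + t) a <-> le x a /\ le t a.
  rewrite /le; split=> [H|[Hx Ht]]; last by rewrite -addA Ht.
  split; first by rewrite -[in LHS]H !addA addxx H.
  by rewrite -[in LHS]H (addC x) !addA addxx (addC t) H.
have : congruence (fun x y => le x a <-> le y a).
  split.
  - by split=> [x|x y|x y z]; tauto.
  - by move=> r s t rs; rewrite !le_add; tauto.
  - by move=> r s t _; rewrite !(lz t).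
  - by move=> r s t; rewrite (lz r) (lz s).
case/(simple_congruence R_simple) => [sep|]; last first.
  by move=> /(_ a b)[/(_ (addxx a))].
have split_R x : x = a \/ x = b.
  case: (pselect (le x a)) => [xa|xa]; [left|right]; apply: sep.
    by rewrite /le addxx.
  by split=> // ba_a; case: ba.
have ab : a + b = b.
  case: (split_R (a + b)) => // aba; case: ba.
  by rewrite /le addC.
have neq_ab : a <> b by move=> e; apply: ba; rewrite /le e addxx.
pose g (s : two) := if s is a2 then a else b.
apply: (@semiring_iso_onto _ S5 g).
- by case=> -[] //= /esym.
- by move=> x; case: (split_R x) => ->; [exists a2 | exists w2].
- by case=> -[] /=; rewrite ?addxx ?ab // addC ab.
- by case=> -[] /=; rewrite lz.
Qed.

(** [(e + x) t = t + x] for all [t]; if [e + x] is an identity this is [t], and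
    if it is a left zero this is independent of [t], hence equal to its value
    [x] at [t = x]. *)
Lemma left_zero_top_or_bottom (e x : R) :
    (forall z, identity z \/ left_zero z) -> identity e -> left_zero x ->
  (forall t, le t x) \/ (forall t, le x t).
Proof.
move=> id_or_lz e_id lz.
have exM t : (e + x) * t = t + x by rewrite mulDl (proj1 (e_id t)) lz.
case: (id_or_lz (e + x)) => [ex_id|ex_lz].
  by right=> t; rewrite /le addC -exM (proj1 (ex_id t)).
by left=> t; rewrite /le -exM ex_lz -(ex_lz x) exM addxx.
Qed.

(** If there is an identity, two distinct left zeros are the bottom and the top,
    which leaves no room for a third one. *)
Lemma left_zeros_iso (p q : R) :
    (forall z, identity z \/ left_zero z) ->
    left_zero p -> left_zero q -> p <> q ->
  semiring_iso R S5 \/ semiring_iso R S7.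
Proof.
move=> id_or_lz.
case: (pselect (exists e, @identity R e)) => [[e e_id]|no_id]; last first.
  move=> _ _ _; left; apply: left_zero_band_iso => x.
  by case: (id_or_lz x) => // x_id; case: no_id; exists x.
have tb := left_zero_top_or_bottom id_or_lz e_id.
wlog : p q / (forall t, le p t) /\ (forall t, le t q).
  move=> IH lzp lzq pq; have qp : q <> p by exact: nesym.
  case: (tb _ lzp) (tb _ lzq) => [tp|bp] [tq|bq].
  - by case: pq; rewrite -(tp q) addC (tq p).
  - exact: (IH q p).
  - exact: (IH p q).
  - by case: pq; rewrite -(bq p) addC (bp q).
move=> [p_bot q_top] lzp lzq pq; right.
have ep : e <> p by move=> H; case: pq; rewrite -(lzp q) -H (proj1 (e_id q)).
have eq : e <> q by move=> H; case: pq; rewrite -(lzq p) -H (proj1 (e_id p)).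
pose g (s : three) := match s with a3 => p | b3 => e | w3 => q end.
apply: (@semiring_iso_onto _ S7 g).
- by case=> -[] //= /esym.
- move=> x; case: (id_or_lz x) => [x_id|lzx].
    by exists b3; apply: identity_unique.
  case: (tb _ lzx) => [x_top|x_bot].
    by exists w3; rewrite /= -(x_top q) addC (q_top x).
  by exists a3; rewrite /= -(x_bot p) addC (p_bot x).
- by case=> -[] /=; rewrite ?addxx ?p_bot ?q_top // addC ?p_bot ?q_top.
- by case=> -[] /=; rewrite ?lzp ?lzq ?(proj1 (e_id _)) ?(proj2 (e_id _)).
Qed.

End LeftZeros.

(** * The converse semiring *)

(** A copy of the carrier, so that the reversed multiplication can be attached to
    it; all congruences are the same as on [R]. *)
Definition converse (R : Type) : Type := R.

Section Converse.
Variable R : semiringType.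
HB.instance Definition _ :=
  Algebra.hasAdd.Build (converse R) (fun x y : R => x + y).
HB.instance Definition _ := hasMul.Build (converse R) (fun x y : R => y * x).
Fact converse_semiring : isSemiring (converse R).
Proof.
split.
- exact: (@semiring_nonempty R).
- exact: (@addA R).
- exact: (@addC R).
- by move=> x y z; exact: (esym (mulA (z : R) y x)).
- by move=> r s t; exact: (@mulDl R).
- by move=> r s t; exact: (@mulDr R).
Qed.
HB.instance Definition _ := converse_semiring.
End Converse.

Lemma converse_simple (R : semiringType) :
  congruence_simple R -> congruence_simple (converse R).
Proof.
move=> [congR neq]; split=> //; rewrite -[RHS]congR.
by apply/seteqP; split=> C [equivC addC mullC mulrC]; split.
Qed.

Lemma iso_of_converse (R S T : semiringType) (h : S -> T) :
    bijective h -> {morph h : x y / x + y} ->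
    {morph h : x y / x * y >-> y * x} ->
  semiring_iso (converse R) S -> semiring_iso R T.
Proof.
move=> hbij hD hM [f [fbij fD fM]]; exists (h \o f); split.
- exact: bij_comp.
- by move=> x y /=; rewrite -hD -fD.
- by move=> x y /=; rewrite -hM -fM.
Qed.

Lemma right_zeros_iso (R : semiringType) (p q : R) :
    congruence_simple R -> (forall x : R, x + x = x) ->
    (forall z : R, identity z \/ forall x : R, x * z = z) ->
    (forall x : R, x * p = p) -> (forall x : R, x * q = q) -> p <> q ->
  semiring_iso R S6 \/ semiring_iso R S8.
Proof.
move=> R_simple addxx id_or_rz rzp rzq pq.
have idP (z : R) : identity z -> @identity (converse R) z.
  by move=> z_id x; have [] := z_id x.
have [z|//|//|//|iso|iso] :=
  @left_zeros_iso (converse R) (converse_simple R_simple) addxx p q.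
- by case: (id_or_rz z) => [/idP|]; [left | right].
- left; apply: (iso_of_converse (h := (id : S5 -> S6))) iso.
  + by exists id.
  + by [].
  + by case=> -[].
- right; apply: (iso_of_converse (h := (id : S7 -> S8))) iso.
  + by exists id.
  + by [].
  + by case=> -[].
Qed.

(** * Constant doubling *)

Section ConstantDoubling.
Variable R : semiringType.
Hypothesis R_idem : mul_idempotent R.
Hypothesis R_simple : congruence_simple R.
Implicit Types x y z e : R.

Lemma doubling_dichotomy :
  (forall x, x + x = x) \/ (forall x y, x + x = y + y).
Proof.
have dd x : x + x + (x + x) = x + x.
  by rewrite -[RHS]R_idem mulDl mulDr R_idem.
apply: (simple_retraction R_simple (f := fun x => x + x)) => // x y.
  exact: addACA.
by rewrite mulDl mulDr dd.
Qed.

Variable c : R.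
Hypothesis addxx : forall x, x + x = c.

Lemma doubling_absorbing : absorbing c.
Proof. by move=> x; rewrite -(addxx c) mulDl mulDr !addxx. Qed.

Let c_abs := doubling_absorbing.

Lemma shift_dichotomy : (forall x, c + x = x) \/ (forall x, c + x = c).
Proof.
have [x y|x y|x|eq_id|eq_const] :=
    @simple_retraction _ R_simple (fun x => c + x).
- by rewrite addACA addxx.
- by rewrite mulDl !mulDr !(proj1 (c_abs _), proj2 (c_abs _)) addA !addxx.
- by rewrite addA addxx.
- by left.
- by right=> x; rewrite (eq_const x c) addxx.
Qed.

(** Here [x y + y x = c] is the zero, so the multiplication is commutative and
    the map [x |-> e x e] is an endomorphism fixing [c]. *)
Lemma boolean_ring_identity e : (forall x, c + x = x) -> e <> c -> identity e.
Proof.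
move=> cx ec.
have mulC x y : x * y = y * x.
  have xy_yx : x * y + y * x = c.
    have : x + y + (x + y) = x + y + (x + x * y + (y * x + y)).
      by rewrite -(sqr_sum x y R_idem).
    rewrite (addC (y * x)) (addACA x (x * y)) (addA (x + y) (x + y)).
    by rewrite !addxx cx => <-.
  by rewrite -[LHS]cx addC -(addxx (y * x)) addA xy_yx cx.
have reg x y z : z * x * z * y * z = z * x * y * z.
  by rewrite (mulC z x) -(mulA x z z) R_idem.
case: (identity_or_sandwich R_simple e R_idem reg) => // /(_ c).
by rewrite (proj2 (c_abs e)) (proj1 (c_abs e)) => /esym.
Qed.

Section ConstantAddition.
Hypothesis add_c : forall x, c + x = c.

(** Multiplying [x + y = x + x y + y x + y] by [x] on the left makes [x y]
    appear twice, so [x + x y = c]. *)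
Lemma constant_addition x y : x + y = c.
Proof.
have x_xy : x + x * y = c.
  have := congr1 (fun z => x * z) (sqr_sum x y R_idem).
  rewrite !mulDr !mulA !R_idem => ->.
  by rewrite (addC (x * y * x)) addA -(addA x) addxx (addC x) !add_c.
by rewrite (sqr_sum x y R_idem) x_xy add_c.
Qed.

(** With a constant addition, collapsing any multiplicative ideal containing [c]
    is a congruence.  The right annihilator of [e] is such an ideal: in a band
    with zero a vanishing product may be reversed, and letters may be inserted
    into it.  It omits [e], so it is trivial. *)
Lemma no_zero_divisor e x : e <> c -> e * x = c -> x = c.
Proof.
move=> ec ex.
have zeroC y z : y * z = c -> z * y = c.
  move=> yz; rewrite -[LHS]R_idem mulA -(mulA z y z) yz.
  by rewrite (proj2 (c_abs z)) (proj1 (c_abs y)).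
have ins t y : e * y = c -> e * (t * y) = c.
  move=> /zeroC ye; rewrite -[LHS]R_idem !mulA -(mulA _ y e) ye.
  by rewrite (proj2 (c_abs _)) !(proj1 (c_abs _)).
have : congruence (fun y z => y = z \/ e * y = c /\ e * z = c).
  split.
  - split=> [y|y z|y z t]; first by left.
      by case=> [->|[? ?]]; [left | right].
    by case=> [->|[? ?]] // [<-|[? ?]]; right.
  - by move=> r s t _; left; rewrite !constant_addition.
  - by move=> r s t [->|[er es]]; [left | right; split; apply: ins].
  - move=> r s t [->|[er es]]; [by left | right].
    by rewrite !mulA er es (proj1 (c_abs t)).
case/(simple_congruence R_simple) => [sep|univ].
  by apply: sep; right; split=> //; rewrite (proj2 (c_abs e)).
by case: (univ e c) => // -[]; rewrite R_idem.
Qed.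

(** Without zero divisors, the partition into [{c}] and its complement is a
    congruence, so [e] is the only element other than [c]. *)
Lemma constant_addition_identity e : e <> c -> identity e.
Proof.
move=> ec.
have mul_c y z : y * z = c <-> y = c \/ z = c.
  split=> [yz|[->|->]]; last 2 first.
  - by rewrite (proj1 (c_abs z)).
  - by rewrite (proj2 (c_abs y)).
  case: (pselect (y = c)) => [|yc]; first by left.
  by right; apply: no_zero_divisor yz.
have : congruence (fun y z => y = c <-> z = c).
  split.
  - by split=> [x|x y|x y z]; tauto.
  - by move=> r s t _; rewrite !constant_addition.
  - by move=> r s t rs; rewrite !mul_c; tauto.
  - by move=> r s t rs; rewrite !mul_c; tauto.
case/(simple_congruence R_simple) => [sep x|]; last first.
  by move=> /(_ c e)[/(_ erefl)].
case: (pselect (x = c)) => [->|xc].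
  by rewrite (proj1 (c_abs e)) (proj2 (c_abs e)).
have -> : x = e by apply: sep.
by rewrite R_idem.
Qed.

End ConstantAddition.

End ConstantDoubling.

(** * Bands with an idempotent addition *)

Section IdempotentAddition.
Variable R : semiringType.
Hypothesis R_idem : mul_idempotent R.
Implicit Types x y z k u v t : R.

(** For a fixed [k], the condition [k u k = k] says that the component of [k] in
    the largest semilattice quotient of the band lies below that of [u]; hence
    it depends only on the set of letters when [u] is a product. *)
Lemma sandwichM k u v :
  k * (u * v) * k = k <-> k * u * k = k /\ k * v * k = k.
Proof.
split=> [|[kuk kvk]].
  rewrite mulA => kuvk; split.
    have -> : k * u * k = k * u * k * u * v * k.
      by rewrite -[X in k * u * X = _]kuvk !mulA.
    by rewrite -(mulA (k * u) k u) R_idem.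
  have -> : k * v * k = k * u * v * k * v * k by rewrite kuvk.
  by rewrite -!mulA (mulA v k (v * k)) R_idem !mulA.
(* [k = k (v k u) k], and squaring [v k u] makes [u v] appear in order. *)
have -> : k * (u * v) * k = k * (v * k * u * (v * k * u)) * k.
  by rewrite -{1}kvk -[X in _ * X = _]kuk !mulA.
by rewrite R_idem !mulA kvk kuk.
Qed.

Hypothesis addxx : forall x, x + x = x.

Lemma le_anti x y : le x y -> le y x -> x = y.
Proof. by rewrite /le => xy yx; rewrite -[LHS]yx addC xy. Qed.

Lemma le_trans x y z : le x y -> le y z -> le x z.
Proof. by rewrite /le => xy <-; rewrite addA xy. Qed.

Lemma le_mull x y t : le x y -> le (t * x) (t * y).
Proof. by rewrite /le -mulDr => ->. Qed.

Lemma le_mulr x y t : le x y -> le (x * t) (y * t).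
Proof. by rewrite /le -mulDl => ->. Qed.

Lemma mul_le_add x y : le (x * y) (x + y).
Proof.
by rewrite /le (sqr_sum x y R_idem) addA (addC (x * y)) -(addA x) addxx.
Qed.

(** Both sides contain the same letters, so [k h k = k] for the left side [k]
    and the right side [h].  Each of the inequalities between [h], [k h], [h k]
    and [k] used below is [x y <= x + y] multiplied by suitable words on both
    sides; they give [k = k h k <= h k <= h <= k]. *)
Lemma regular_band x y z : z * x * z * y * z = z * x * y * z.
Proof.
set k := LHS; set h := RHS.
have khk : k * h * k = k.
  have : k * (z * x * z * y * z) * k = k by rewrite !R_idem.
  by rewrite /h !sandwichM; tauto.
have hk : le h k.
  have -> : h = z * x * z * (x * y) * (z * y * z).
    rewrite !mulA -(mulA (z * x) z x) R_idem.
    by rewrite -!mulA (mulA y z (y * z)) R_idem !mulA.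
  have -> : k = z * x * z * (x + y) * (z * y * z).
    rewrite mulDr mulDl !mulA -(mulA (z * x) z x) R_idem.
    have -> : z * x * z * y * z * y * z = k.
      by rewrite -!mulA (mulA y z (y * z)) R_idem !mulA.
    by rewrite addxx.
  exact/le_mulr/le_mull/mul_le_add.
have khh : le (k * h) h.
  have -> : k * h = z * x * (z * (y * z)) * h by rewrite !mulA.
  have {2}-> : h = z * x * (z + y * z) * h.
    rewrite mulDr mulDl (mulA (z * x) y z) R_idem.
    have -> : z * x * z * h = h.
      by rewrite !mulA -(mulA (z * x) z z) R_idem -(mulA (z * x) z x) R_idem.
    by rewrite addxx.
  exact/le_mulr/le_mull/mul_le_add.
have hkh : le (h * k) h.
  have -> : h * k = h * (z * x * z * (y * z)) by rewrite !mulA.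
  have {2}-> : h = h * ((z * x + z) * (y * z)).
    rewrite mulDl mulDr (mulA (z * x) y z) R_idem.
    have -> : h * (z * (y * z)) = h.
      rewrite !mulA -(mulA (z * x * y) z z) R_idem.
      by rewrite -!mulA (mulA y z (y * z)) R_idem !mulA.
    by rewrite addxx.
  exact/le_mull/le_mulr/mul_le_add.
apply: le_anti => //; rewrite -[k in le k h]khk.
exact: le_trans (le_mulr k khh) hkh.
Qed.

End IdempotentAddition.

(** * The classification *)

Section Classification.
Variable R : semiringType.
Hypothesis R_idem : mul_idempotent R.
Hypothesis R_simple : congruence_simple R.
Implicit Types x y z e : R.

(** Let [K] be the set of [t] with [t z t = t] for all [z].  As [K] is an ideal, [t x = t y] for all [t] in [K] defines a
    congruence in [x] and [y].  If it is universal, [e x = e e = e] for [e] in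
    [K].  If it is equality, [t x e = t e] in the rectangular band [K] gives
    [x e = e]. *)
Lemma sandwich_left_or_right_zeros :
  (forall e, (forall x, e * x * e = e) -> left_zero e) \/
  (forall e, (forall x, e * x * e = e) -> forall x, x * e = e).
Proof.
have : congruence (fun x y : R =>
    forall t, (forall z, t * z * t = t) -> t * x = t * y).
  split.
  - split=> [//|x y xy t tK|x y z xy yz t tK]; first by rewrite xy.
    by rewrite xy // yz.
  - by move=> r s t rs u uK; rewrite !mulDr rs.
  - move=> r s t rs u uK; rewrite !mulA; apply: rs => z.
    by rewrite !mulA -(mulA u t z) uK.
  - by move=> r s t rs u uK; rewrite !mulA rs.
case/(simple_congruence R_simple) => [sep|univ]; [right | left].
  move=> e eK x; apply: sep => t tK.
  by rewrite -[X in t * (x * X) = _](eK t) !mulA -(mulA t x e) tK.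
by move=> e eK x; rewrite (univ x e e eK) R_idem.
Qed.

Lemma idempotent_addition_iso :
    (forall x, x + x = x) ->
  semiring_iso R S1 \/ semiring_iso R S2 \/ semiring_iso R S3 \/
  semiring_iso R S4 \/ semiring_iso R S5 \/ semiring_iso R S6 \/
  semiring_iso R S7 \/ semiring_iso R S8.
Proof.
move=> addxx.
have id_or_K e := identity_or_sandwich R_simple e R_idem (regular_band R_idem addxx).
have [c cK] : exists c : R, forall x, c * x * c = c.
  have [x [y xy]] := simple_nontrivial R_simple.
  case: (id_or_K x) => [x_id|]; last by exists x.
  case: (id_or_K y) => [y_id|]; last by exists y.
  by case: xy; apply: identity_unique.
case: (pselect (exists2 d, (forall x, d * x * d = d) & d <> c)) => [[d dK dc]|Kc];
    last first.
  have cP x : (forall y, x * y * x = x) -> x = c.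
    by move=> xK; apply: contrapT => xc; apply: Kc; exists x.
  have c_abs : absorbing c.
    move=> x; split; apply: cP => y; rewrite !mulA.
      by rewrite -(mulA c x) cK.
    by rewrite -!mulA (mulA y x c) (mulA c (y * x) c) cK.
  have [e ec] := simple_nontrivial_at R_simple c.
  have nc_id x : x <> c -> identity x.
    by case: (id_or_K x) => // /cP.
  by have := absorbing_or_identity_iso c_abs ec nc_id; tauto.
case: sandwich_left_or_right_zeros => Kz.
  have id_or_lz z : identity z \/ left_zero z.
    by case: (id_or_K z) => [|/Kz]; [left | right].
  have := left_zeros_iso R_simple addxx id_or_lz (Kz d dK) (Kz c cK) dc.
  by tauto.
have id_or_rz z : identity z \/ forall x, x * z = z.
  by case: (id_or_K z) => [|/Kz]; [left | right].
have := right_zeros_iso R_simple addxx id_or_rz (Kz d dK) (Kz c cK) dc.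
by tauto.
Qed.

Lemma constant_doubling_iso (c : R) :
    (forall x, x + x = c) ->
  semiring_iso R S1 \/ semiring_iso R S2 \/ semiring_iso R S3 \/
  semiring_iso R S4.
Proof.
move=> addxx; have [e ec] := simple_nontrivial_at R_simple c.
apply: absorbing_or_identity_iso (doubling_absorbing addxx) ec _ => x.
case: (shift_dichotomy R_simple addxx) => [cx|add_c].
  exact: boolean_ring_identity.
exact: constant_addition_identity.
Qed.

End Classification.

Lemma finite_semiring_iso (R S : semiringType) :
  semiring_iso R S -> finite_set [set: S] -> finite_set [set: R].
Proof.
move=> [f [[g fK gK] _ _]] finS.
apply: sub_finite_set (finite_image g finS) => x _.
by exists (f x).
Qed.

Lemma finite_two : finite_set [set: two].
Proof.
apply: (@sub_finite_set _ _ [set w2; a2]) => [[]|]; [by left|by right|].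
by rewrite finite_setU; split; exact: finite_set1.
Qed.

Lemma finite_three : finite_set [set: three].
Proof.
apply: (@sub_finite_set _ _ [set a3; b3; w3]) => [[]|].
- by left; left.
- by left; right.
- by right.
by rewrite !finite_setU; split; [split|]; exact: finite_set1.
Qed.

Theorem theorem3p7 (R : semiringType) (R_idem : mul_idempotent R)
    (R_simple : congruence_simple R) :
  finite_set [set: R] /\
  (semiring_iso R S1 \/ semiring_iso R S2 \/ semiring_iso R S3 \/
   semiring_iso R S4 \/ semiring_iso R S5 \/ semiring_iso R S6 \/
   semiring_iso R S7 \/ semiring_iso R S8).
Proof.
suff iso : semiring_iso R S1 \/ semiring_iso R S2 \/ semiring_iso R S3 \/
   semiring_iso R S4 \/ semiring_iso R S5 \/ semiring_iso R S6 \/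
   semiring_iso R S7 \/ semiring_iso R S8.
  split=> //; move: iso.
  by do 7?[case; [move=> /finite_semiring_iso; apply; first
    [exact: finite_two | exact: finite_three] |]];
    move=> /finite_semiring_iso; apply; exact: finite_three.
case: (doubling_dichotomy R_idem R_simple) => [addxx|const].
  exact: idempotent_addition_iso.
have [x0 _] := simple_nontrivial R_simple.
have := @constant_doubling_iso R R_idem R_simple (x0 + x0) (const^~ x0).
by tauto.
Qed.
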